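(* Let $(L,Q,\mathcal{M}=Z+\mathcal{D})$ be a nonholonomic mechanical system with affine constraints, with constraint manifold $M\subset TQ$ and reaction-annihilator distribution $\mathcal{R}^\circ$. (i) Let $Y$ be a vector field on $Q$. If $Y^{TQ}(L)|_M=0$, then $E_{L,Y}|_M$ is a first integral of $(L,Q,\mathcal{M}=Z+\mathcal{D})$ if and only if $Y-Z\in\Gamma(\mathcal{R}^\circ)$. (ii) If $Z^{TQ}(L)|_M=0$, then $E_{L,Z}|_M=\big(E_L-\langle p,Z\rangle\big)|_M$ is a first integral of $(L,Q,\mathcal{M}=Z+\mathcal{D})$. (iii) Assume that $L$ is invariant under the tangent lift $\Psi^{TQ}$ of an action $\Psi$ of a Lie group $G$ on $Q$, namely $L\circ\Psi^{TQ}_g=L$ for all $g\in G$. Then for any $\xi$ in the Lie algebra $\mathfrak{g}$ of $G$, $E_{L,Y_\xi}|_M$ is a first integral of $(L,Q,\mathcal{M}=Z+\mathcal{D})$ if and only if $Y_\xi-Z\in\Gamma(\mathcal{R}^\circ)$, where $Y_\xi$ is the infinitesimal generator of $\xi$.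
   Context: All objects are smooth and all vector fields are complete. $Q$ is an $n$-dimensional manifold. The Lagrangian $L:TQ\to\mathbb{R}$ has the form $L=T+b-V\circ\pi$, with $T$ the kinetic energy of a Riemannian metric on $Q$, $b$ a 1-form on $Q$ regarded as a function on $TQ$, $V$ a function on $Q$, and $\pi:TQ\to Q$ the projection. In bundle coordinates $(q,\dot q)$, $L(q,\dot q)=\frac12\dot q\cdot A(q)\dot q+b(q)\cdot\dot q-V(q)$ with $A$ symmetric and positive definite. $\mathcal{D}$ is a nonintegrable distribution on $Q$ of constant rank $r$, $1<r<n$, and $Z$ is a vector field on $Q$. The affine constraint distribution $\mathcal{M}=Z+\mathcal{D}$ has fibers $\mathcal{M}_q=Z(q)+\mathcal{D}_q\subset T_qQ$; the submanifold $M\subset TQ$ with fibers $\mathcal{M}_q$ is the constraint manifold. The constraint is ideal (d'Alembert): the equations of motion are the restriction to $M$ of $\frac{d}{dt}\frac{\partial L}{\partial\dot q}-\frac{\partial L}{\partial q}=R$, where $R:M\to\mathcal{D}^\circ$, $R(v_q)\in\mathcal{D}_q^\circ$ (annihilator of $\mathcal{D}_q$), is the unique such function (the reaction force) for which these equations define a dynamics on $M$. In coordinates, if $\mathcal{D}_q=\ker S(q)$ with $S(q)$ a $k\times n$ matrix of rank $k=n-r$, and $s=-SZ$, then $R=S^T(SA^{-1}S^T)^{-1}(SA^{-1}\ell-\sigma)$ with $\ell_i=\sum_j\frac{\partial^2L}{\partial\dot q_i\partial q_j}\dot q_j-\frac{\partial L}{\partial q_i}$ and $\sigma_a=\sum_{i,j}\frac{\partial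 S_{ai}}{\partial q_j}\dot q_i\dot q_j+\sum_j\frac{\partial s_a}{\partial q_j}\dot q_j$. A first integral of $(L,Q,\mathcal{M})$ is a function on $M$ constant along all solutions of the equations of motion. The reaction-annihilator distribution $\mathcal{R}^\circ$ has fiber $\mathcal{R}^\circ_q$ equal to the annihilator in $T_qQ$ of $\mathcal{R}_q=\bigcup_{v_q\in\mathcal{M}_q}R(v_q)\subset\mathcal{D}_q^\circ$. Thus a vector field $W$ is in $\Gamma(\mathcal{R}^\circ)$ (i.e. is a section of $\mathcal{R}^\circ$) iff $\langle R(v_q),W(q)\rangle=0$ for all $q\in Q$, $v_q\in\mathcal{M}_q$. $p$ is the momentum 1-form generated by $L$ (in coordinates $p=\partial L/\partial\dot q$), $E_L:=\langle p,\cdot\rangle-L$ is the energy (in coordinates $E_L=p\cdot\dot q-L$), and for a vector field $Y$ on $Q$, $E_{L,Y}:=E_L-\langle p,Y\rangle$, a function on $TQ$. The tangent lift of $Y$ is the vector field on $TQ$ given by $Y^{TQ}=\sum_iY_i\partial_{q_i}+\sum_{i,j}\dot q_j\frac{\partial Y_i}{\partial q_j}\partial_{\dot q_i}$. The infinitesimal generator of $\xi\in\mathfrak{g}$ is $Y_\xi=\frac{d}{dt}\Psi_{\exp(t\xi)}|_{t=0}$, and the tangent lift of the action is $\Psi^{TQ}_g(v_q)=T_q\Psi_g\cdot v_q$. *)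

(* Defs.v *)
From HB Require Import structures.
From mathcomp Require Export all_boot all_order all_algebra.
From mathcomp Require Export all_classical all_reals all_analysis.
Export numFieldNormedType.Exports.

Set Implicit Arguments.
Unset Strict Implicit.
Unset Printing Implicit Defensive.
Import Order.TTheory GRing.Theory Num.Theory.

Local Open Scope ring_scope.
Local Open Scope classical_set_scope.

(* Only used on open sets [U], so that the pointwise notions below do not
   depend on the values of [f] outside [U]. *)
Fixpoint Ck_on (R : realType) (E F : normedModType R) (k : nat)
    (U : set E) (f : E -> F) : Prop :=
  match k with
  | 0%N => forall x, U x -> {for x, continuous f}
  | k'.+1 => (forall x, U x -> differentiable f x) /\
             (forall v : E, Ck_on k' U (fun x => 'D_v f x))
  end.

Definition smooth_on (R : realType) (E F : normedModType R)
    (U : set E) (f : E -> F) : Prop := forall k, Ck_on k U f.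

(* The pairing of a covector with a vector; both are given by their components,
   with respect to dual bases, as row vectors. *)
Definition pairing (R : realType) (n : nat) (a u : 'rV[R]_n) : R :=
  \sum_(i < n) a 0 i * u 0 i.

(* [cmap] and [cinv] are total functions, relevant only on [cdom] and on
   [cim] respectively. *)
Record chart (R : realType) (Q : topologicalType) (n : nat) := Chart {
  cdom : set Q ;
  cmap :> Q -> 'rV[R]_n ;
  cinv : 'rV[R]_n -> Q ;
  cdom_open : open cdom ;
  cim_open : open (cmap @` cdom) ;
  cmapK : forall q, cdom q -> cinv (cmap q) = q ;
  cmap_continuous : forall q, cdom q -> {for q, continuous cmap} ;
  cinv_continuous : forall x, (cmap @` cdom) x -> {for x, continuous cinv}
}.

Definition cim (R : realType) (Q : topologicalType) (n : nat)
  (c : chart R Q n) : set 'rV[R]_n := c @` cdom c.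

(* [chart_at q] is a preferred chart at [q]. It carries no geometric content:
   it only serves to represent tangent vectors at [q], see below. *)
Record manifold (R : realType) (n : nat) := Manifold {
  points :> topologicalType ;
  points_hausdorff : hausdorff_space points ;
  points_second_countable : @second_countable points ;
  atlas : set (chart R points n) ;
  atlas_compatible : forall c c', atlas c -> atlas c' ->
    smooth_on (c @` (cdom c `&` cdom c')) (c' \o cinv c) ;
  chart_at : points -> chart R points n ;
  chart_at_atlas : forall q, atlas (chart_at q) ;
  chart_at_dom : forall q, cdom (chart_at q) q
}.

(* For every [q], the tangent space T_qQ is identified with R^n through
   [chart_at q]: a tangent vector at [q] is represented by its components in
   the chart [chart_at q], and likewise for covectors. A function on TQ is thus
   a function [Q -> 'rV_n -> R] and a vector field a function [Q -> 'rV_n].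
   [tcoord c q] maps a tangent vector at [q] to its components in the chart
   [c]; [tvec c x] is the inverse operation, at the point with coordinates
   [x]. *)
Definition tcoord (R : realType) (n : nat) (Q : manifold R n)
    (c : chart R Q n) (q : Q) (v : 'rV[R]_n) : 'rV[R]_n :=
  'd (c \o cinv (chart_at q)) (chart_at q q) v.

Definition tvec (R : realType) (n : nat) (Q : manifold R n)
    (c : chart R Q n) (x w : 'rV[R]_n) : 'rV[R]_n :=
  'd (chart_at (cinv c x) \o cinv c) x w.

Definition tangent_map (R : realType) (m n : nat)
    (P : manifold R m) (Q : manifold R n) (f : P -> Q) (p : P)
    (v : 'rV[R]_m) : 'rV[R]_n :=
  'd (chart_at (f p) \o f \o cinv (chart_at p)) (chart_at p p) v.

(* [U] is meant to be open. *)
Definition smooth_into (R : realType) (E : normedModType R) (n : nat)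
    (Q : manifold R n) (U : set E) (f : E -> Q) : Prop :=
  (forall u, U u -> {for u, continuous f}) /\
  (forall c, @atlas R n Q c -> smooth_on (U `&` f @^-1` cdom c) (c \o f)).

Definition smooth_map (R : realType) (m n : nat)
    (P : manifold R m) (Q : manifold R n) (f : P -> Q) : Prop :=
  continuous f /\
  (forall c d, @atlas R m P c -> @atlas R n Q d ->
     smooth_on (c @` (cdom c `&` f @^-1` cdom d)) (d \o f \o cinv c)).

Definition smooth_map2 (R : realType) (l m n : nat)
    (P : manifold R l) (P' : manifold R m) (Q : manifold R n)
    (f : P -> P' -> Q) : Prop :=
  continuous (fun z : P * P' => f z.1 z.2) /\
  (forall c c' d, @atlas R l P c -> @atlas R m P' c' -> @atlas R n Q d ->
     smooth_on
       [set z : 'rV[R]_l * 'rV[R]_m |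
          [/\ cim c z.1, cim c' z.2 & cdom d (f (cinv c z.1) (cinv c' z.2))]]
       (fun z => d (f (cinv c z.1) (cinv c' z.2)))).

Definition smooth_fun (R : realType) (n : nat) (Q : manifold R n)
    (f : Q -> R) : Prop :=
  forall c, @atlas R n Q c -> smooth_on (cim c) (f \o cinv c).

Definition velocity (R : realType) (n : nat) (Q : manifold R n)
    (gamma : R -> Q) (t : R) : 'rV[R]_n :=
  derive1 (chart_at (gamma t) \o gamma) t.

Definition vf_loc (R : realType) (n : nat) (Q : manifold R n)
    (c : chart R Q n) (X : Q -> 'rV[R]_n) (x : 'rV[R]_n) : 'rV[R]_n :=
  tcoord c (cinv c x) (X (cinv c x)).

Definition smooth_vf_on (R : realType) (n : nat) (Q : manifold R n)
    (U : set Q) (X : Q -> 'rV[R]_n) : Prop :=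
  forall c, @atlas R n Q c -> smooth_on (c @` (cdom c `&` U)) (vf_loc c X).

Definition complete_vf (R : realType) (n : nat) (Q : manifold R n)
    (X : Q -> 'rV[R]_n) : Prop :=
  forall q, exists gamma : R -> Q,
    [/\ smooth_into setT gamma, gamma 0 = q &
        forall t, velocity gamma t = X (gamma t)].

Definition vector_field (R : realType) (n : nat) (Q : manifold R n)
    (X : Q -> 'rV[R]_n) : Prop :=
  smooth_vf_on setT X /\ complete_vf X.

Definition smooth_distribution (R : realType) (n r : nat) (Q : manifold R n)
    (D : Q -> {vspace 'rV[R]_n}) : Prop :=
  forall q0 : Q, exists (U : set Q) (X : 'I_r -> Q -> 'rV[R]_n),
    [/\ open U, U q0, forall i, smooth_vf_on U (X i) &
        forall q, U q ->
          \dim (D q) = r /\ D q = <<[seq X i q | i <- enum 'I_r]>>%VS].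

(* A distribution of rank [r] is integrable if through each point there passes
   an integral manifold. As [D] has rank [r], the parametrization [f] in the
   definition is necessarily an immersion. *)
Definition integrable_distribution (R : realType) (n r : nat)
    (Q : manifold R n) (D : Q -> {vspace 'rV[R]_n}) : Prop :=
  forall q : Q, exists (U : set 'rV[R]_r) (f : 'rV[R]_r -> Q),
    [/\ open U, U 0, f 0 = q, smooth_into U f &
        forall u, U u -> forall v : 'rV[R]_n,
          v \in D (f u) <->
          exists w : 'rV[R]_r, v = 'd (chart_at (f u) \o f) u w].

(* [metric q] is the Gram matrix of the Riemannian metric at [q], and
   [gyro q] the covector b(q), in the chart [chart_at q]. *)
Record nh_system (R : realType) (n r : nat) := NhSystem {
  conf : manifold R n ;
  metric : conf -> 'M[R]_n ;
  metric_sym : forall q, (metric q)^T = metric q ;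
  metric_pos : forall q (v : 'rV[R]_n), v != 0 ->
    0 < pairing (v *m metric q) v ;
  metric_smooth : forall c, @atlas R n conf c -> forall u w : 'rV[R]_n,
    smooth_on (cim c) (fun x =>
      pairing (tvec c x u *m metric (cinv c x)) (tvec c x w)) ;
  gyro : conf -> 'rV[R]_n ;
  gyro_smooth : forall c, @atlas R n conf c -> forall w : 'rV[R]_n,
    smooth_on (cim c) (fun x => pairing (gyro (cinv c x)) (tvec c x w)) ;
  potential : conf -> R ;
  potential_smooth : smooth_fun potential ;
  rank_bounds : (1 < r < n)%N ;
  distr : conf -> {vspace 'rV[R]_n} ;
  distr_smooth : smooth_distribution r distr ;
  distr_nonintegrable : ~ integrable_distribution r distr ;
  drift : conf -> 'rV[R]_n ;
  drift_vf : vector_field drift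
}.

Arguments metric {R n r} _ _.
Arguments gyro {R n r} _ _.
Arguments potential {R n r} _ _.
Arguments distr {R n r} _ _.
Arguments drift {R n r} _ _.

Section Mechanics.
Variables (R : realType) (n r : nat) (S : nh_system R n r).

Local Notation Q := (conf S).
Local Notation Z := (drift S).
Local Notation D := (distr S).

Definition lagrangian (q : Q) (v : 'rV[R]_n) : R :=
  2^-1 * pairing (v *m metric S q) v + pairing (gyro S q) v - potential S q.

(* [cmanifold q v] says that the tangent vector [v] at [q] is in M. *)
Definition cmanifold (q : Q) (v : 'rV[R]_n) : Prop := v - Z q \in D q.

Definition momentum (q : Q) (v : 'rV[R]_n) : 'rV[R]_n :=
  \row_(i < n) 'D_(delta_mx 0 i) (lagrangian q) v.

Definition energy (q : Q) (v : 'rV[R]_n) : R :=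
  pairing (momentum q v) v - lagrangian q v.

Definition moving_energy (Y : Q -> 'rV[R]_n) (q : Q) (v : 'rV[R]_n) : R :=
  energy q v - pairing (momentum q v) (Y q).

(* [z] = (x, w) are the bundle coordinates defined by [c] on TQ. *)
Definition tfun_loc (c : chart R Q n) (F : Q -> 'rV[R]_n -> R)
    (z : 'rV[R]_n * 'rV[R]_n) : R :=
  F (cinv c z.1) (tvec c z.1 z.2).

(* Components of the tangent lift of [Y] in the bundle coordinates of [c]. *)
Definition tangent_lift_loc (c : chart R Q n) (Y : Q -> 'rV[R]_n)
    (z : 'rV[R]_n * 'rV[R]_n) : 'rV[R]_n * 'rV[R]_n :=
  (vf_loc c Y z.1, 'D_(z.2) (vf_loc c Y) z.1).

(* The function Y^TQ(F), computed at (q, v) in the chart [chart_at q], in which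
   the components of [v] are [v] itself. *)
Definition tangent_lift (Y : Q -> 'rV[R]_n) (F : Q -> 'rV[R]_n -> R)
    (q : Q) (v : 'rV[R]_n) : R :=
  let c := chart_at q in
  'D_(tangent_lift_loc c Y (c q, v)) (tfun_loc c F) (c q, v).

(* [el_operator a q v u] is the component along [u] of
   (d/dt)(dL/dq') - dL/dq at the 1-jet (q, v), with acceleration [a] in the
   chart [chart_at q]. *)
Definition el_operator (a : 'rV[R]_n) (q : Q) (v u : 'rV[R]_n) : R :=
  let c := chart_at q in
  let l := tfun_loc c lagrangian in
  'D_(v, a) (fun z => 'D_(0, u) l z) (c q, v) - 'D_(u, 0) l (c q, v).

(* The second-order tangent vector (v, a) to TQ at (q, v), written in the bundle
   coordinates of [chart_at q], is tangent to M. *)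
Definition tangent_to_cmanifold (q : Q) (v a : 'rV[R]_n) : Prop :=
  let c := chart_at q in
  exists (J : set R) (x w : R -> 'rV[R]_n),
    [/\ open J, J 0, smooth_on J x & smooth_on J w] /\
    [/\ x 0 = c q, w 0 = v, derive1 x 0 = v & derive1 w 0 = a] /\
    (forall t, J t ->
       cim c (x t) /\ cmanifold (cinv c (x t)) (tvec c (x t) (w t))).

Definition annihilator (A : set 'rV[R]_n) : set 'rV[R]_n :=
  [set b | forall a, A a -> pairing a b = 0].

(* [rho] annihilates D_q, and the equations of motion with right-hand side [rho]
   determine at (q, v) a second-order vector which is tangent to M. *)
Definition is_reaction_force_at (q : Q) (v rho : 'rV[R]_n) : Prop :=
  annihilator [set` D q] rho /\
  exists a, tangent_to_cmanifold q v a /\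
    forall u, el_operator a q v u = pairing rho u.

(* If (q, v) is in M then there is exactly one such covector, because the metric
   is positive definite; the value outside M is irrelevant. *)
Definition reaction_force (q : Q) (v : 'rV[R]_n) : 'rV[R]_n :=
  get (is_reaction_force_at q v).

(* [gamma] is a solution of the equations of motion on the open time interval
   [J]; the equation at time [t] is written in the chart [chart_at (gamma t)],
   and its terms are components of covectors. *)
Definition solution (J : set R) (gamma : R -> Q) : Prop :=
  smooth_into J gamma /\
  forall t, J t ->
    cmanifold (gamma t) (velocity gamma t) /\
    let c := chart_at (gamma t) in
    let l := tfun_loc c lagrangian in
    let x := c \o gamma in
    forall u : 'rV[R]_n,
      derive1 (fun s => 'D_(0, u) l (x s, derive1 x s)) t
        - 'D_(u, 0) l (x t, derive1 x t)
      = pairing (reaction_force (gamma t) (velocity gamma t)) u.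

(* Completeness of the dynamics, i.e. of the vector field on M which is defined
   by the equations of motion. *)
Definition complete_dynamics : Prop :=
  forall q v, cmanifold q v -> exists gamma : R -> Q,
    [/\ solution setT gamma, gamma 0 = q & velocity gamma 0 = v].

(* Only the restriction of [F] to M matters. *)
Definition first_integral (F : Q -> 'rV[R]_n -> R) : Prop :=
  forall (J : set R) (gamma : R -> Q), open J -> is_interval J ->
    solution J gamma ->
    forall s t, J s -> J t ->
      F (gamma s) (velocity gamma s) = F (gamma t) (velocity gamma t).

(* The fibers R_q and R^o_q; [W] is a section of the latter. *)
Definition reaction_set (q : Q) : set 'rV[R]_n :=
  reaction_force q @` [set v | cmanifold q v].

Definition reaction_annihilator (q : Q) : set 'rV[R]_n :=
  annihilator (reaction_set q).

Definition section_RA (W : Q -> 'rV[R]_n) : Prop :=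
  smooth_vf_on setT W /\ forall q, reaction_annihilator q (W q).

End Mechanics.

Arguments lagrangian {R n r} S q v.
Arguments cmanifold {R n r} S q v.
Arguments section_RA {R n r} S W.

Record lie_group (R : realType) (m : nat) := LieGroup {
  gman :> manifold R m ;
  gone : gman ;
  gmul : gman -> gman -> gman ;
  ginv : gman -> gman ;
  gmulA : forall g h k, gmul g (gmul h k) = gmul (gmul g h) k ;
  gmul1 : forall g, gmul gone g = g ;
  gmulV : forall g, gmul (ginv g) g = gone ;
  gmul_smooth : smooth_map2 gmul ;
  ginv_smooth : smooth_map ginv
}.

(* The Lie algebra is the tangent space at the identity, hence R^m. The
   exponential map is the map such that t |-> exp (t xi) is the one-parameter
   subgroup with velocity xi at t = 0. *)
Definition exponential_map (R : realType) (m : nat) (G : lie_group R m)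
    (exp : 'rV[R]_m -> G) : Prop :=
  forall xi : 'rV[R]_m,
    [/\ smooth_into setT (fun t : R => exp (t *: xi)),
        exp 0 = gone G,
        velocity (fun t : R => exp (t *: xi)) 0 = xi &
        forall s t : R,
          exp ((s + t) *: xi) = gmul (exp (s *: xi)) (exp (t *: xi))].

Definition lie_action (R : realType) (m n : nat) (G : lie_group R m)
    (Q : manifold R n) (Psi : G -> Q -> Q) : Prop :=
  [/\ smooth_map2 Psi, forall q, Psi (gone G) q = q &
      forall g h q, Psi (gmul g h) q = Psi g (Psi h q)].

(* The chart [chart_at q] is the right one since Psi_(exp 0) q = q. *)
Definition generator (R : realType) (m n : nat) (G : lie_group R m)
    (Q : manifold R n) (exp : 'rV[R]_m -> G) (Psi : G -> Q -> Q)
    (xi : 'rV[R]_m) (q : Q) : 'rV[R]_n :=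
  derive1 (fun t : R => chart_at q (Psi (exp (t *: xi)) q)) 0.

(* Main.v *)
From HB Require Import structures.
Require Import Defs.
From mathcomp Require Import ring lra.

Set Implicit Arguments.
Unset Strict Implicit.
Unset Printing Implicit Defensive.
Import Order.TTheory GRing.Theory Num.Theory.

Local Open Scope ring_scope.
Local Open Scope classical_set_scope.

(** Everything follows from one balance law. In bundle coordinates (q, w) the
   moving energy is p.(w - Y) - L with p = dL/dw, and along a solution, where
   w = q', the product rule gives
     d/dt (p.(w - Y) - L) = <dp/dt - dL/dq, w - Y> - Y^TQ(L)
                          = <R, w - Y> - Y^TQ(L),
   because the derivative of L along the curve cancels all the other terms
   ([is_derive_moving_energy], [is_derive_moving_energy_solution]). On M the
   vector w - Z lies in D and the reaction force R annihilates D, so that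
   <R, w - Y> = - <R, Y - Z> ([reaction_power]). If Y^TQ(L) vanishes on M, the
   rate of change of the moving energy is therefore - <R, Y - Z>. It vanishes
   along all solutions if Y - Z is a section of the reaction-annihilator
   distribution; conversely, a solution passes through every point of M because
   the dynamics is complete, so that a first integral forces
   <R(v_q), Y - Z> = 0 at every v_q in M ([moving_energy_first_integral]). This
   is (i), and (ii) is the case Y = Z, where Y - Z = 0.

   For (iii) the generator Y has to be shown to be smooth and to satisfy
   Y^TQ(L) = 0. In coordinates Y is a partial derivative at the identity of the
   smooth map (g, x) |-> Psi_g(x) ([generator_loc]), hence it is smooth. The
   invariance of L says that L is constant along the curve
   t |-> (Psi_exp(t xi)(x), D_v Psi_exp(t xi)(x)), whose velocity at t = 0 is
   (Y, d/dt D_v Psi_exp(t xi)). The second component equals D_v Y by the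
   symmetry of second derivatives ([derive_comm], [action_mixed]), so that this
   velocity is the tangent lift of Y and Y^TQ(L) = 0
   ([invariant_tangent_lift]).

   All these computations take place in a single chart, whereas tangent vectors
   at different points are represented in different charts. The chain rule for
   transition maps ([chart_change], [transitionK]) reconciles the two:
   velocities, momenta and vector fields are first rewritten in one chart. *)

(** * Differentiable and C^k functions on normed spaces *)

Section Derivatives.
Variables (R : realType) (E F G : normedModType R).

Lemma near_eq_differentiable (f g : E -> F) (x : E) :
  (\near x, f x = g x) -> differentiable f x -> differentiable g x.
Proof.
move=> fg df; have fgx := nbhs_singleton fg.
have gE : g \o shift x = cst (g x) + 'd f x +o_ 0 id.
  apply/eqaddoP => e e0.
  have /eqaddoP/(_ e e0) H := diff_locally df.
  have fg0 : \forall y \near 0, f (y + x) = g (y + x).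
    by move: fg; rewrite (near_shift 0 x) /= subr0; apply: filterS => y.
  near=> y.
  have -> : (g \o shift x - (cst (g x) + 'd f x)) y
          = (f \o shift x - (cst (f x) + 'd f x)) y.
    rewrite /= !fctE /=; congr (_ - (_ + _)) => //.
    by apply/esym; near: y.
  by near: y.
have dE : 'd g x = 'd f x :> (E -> F).
  by apply: diff_unique => //; exact: diff_continuous.
apply/diff_locallyP; rewrite dE; split => //; exact: diff_continuous.
Unshelve. all: by end_near. Qed.

Lemma derive_comp (f : E -> F) (g : F -> G) (x v : E) :
  differentiable f x -> differentiable g (f x) ->
  'D_v (g \o f) x = 'D_('D_v f x) g (f x).
Proof.
move=> df dg; have dgf : differentiable (g \o f) x.
  exact: differentiable_comp.
by rewrite (deriveE v dgf) (deriveE v df) (deriveE _ dg) diff_comp.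
Qed.

Lemma derive_dirD (f : E -> F) (x u v : E) : differentiable f x ->
  'D_(u + v) f x = 'D_u f x + 'D_v f x.
Proof. by move=> df; rewrite !(deriveE _ df) linearD. Qed.

Lemma derive_dirB (f : E -> F) (x u v : E) : differentiable f x ->
  'D_(u - v) f x = 'D_u f x - 'D_v f x.
Proof. by move=> df; rewrite !(deriveE _ df) linearB. Qed.

Lemma derive_dirZ (f : E -> F) (x u : E) (a : R) : differentiable f x ->
  'D_(a *: u) f x = a *: 'D_u f x.
Proof. by move=> df; rewrite !(deriveE _ df) linearZ. Qed.

Lemma derive_dir_sum (f : E -> F) (x : E) (I : Type) (s : seq I) (u : I -> E) :
  differentiable f x ->
  'D_(\sum_(i <- s) u i) f x = \sum_(i <- s) 'D_(u i) f x.
Proof.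
move=> df; rewrite (deriveE _ df) linear_sum.
by apply: eq_bigr => i _; rewrite (deriveE _ df).
Qed.

Lemma derive_pair (f : E -> F) (g : E -> G) (x v : E) :
  differentiable f x -> differentiable g x ->
  'D_v (fun y => (f y, g y)) x = ('D_v f x, 'D_v g x).
Proof.
move=> df dg; have dfg := differentiable_pair df dg.
by rewrite (deriveE v dfg) (deriveE v df) (deriveE v dg) diff_pair.
Qed.

End Derivatives.

Section Fibers.
Variables (R : realType) (E F G : normedModType R).

Lemma is_diff_fiber (x : E) (w : F) :
  is_diff w (fun v : F => (x, v)) (fun v => (0, v)).
Proof. exact: is_diff_pair (is_diff_cst x w) (is_diff_id w). Qed.

Lemma derive_fiber_incl (l : E * F -> G) (x : E) (w u : F) :
  differentiable l (x, w) ->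
  differentiable (fun v => l (x, v)) w /\
  'D_u (fun v => l (x, v)) w = 'D_(0, u) l (x, w).
Proof.
move=> dl; have [df fE] := is_diff_fiber x w.
split; first exact: (@differentiable_comp _ _ _ _ (fun v : F => (x, v)) l).
by rewrite -[LHS]/('D_u (l \o (fun v : F => (x, v))) w)
  (derive_comp _ df dl) (deriveE _ df) fE.
Qed.

End Fibers.

Section Ck.
Variables (R : realType).
Implicit Types (E F G : normedModType R).

Lemma Ck_on_sub E F k (U V : set E) (f : E -> F) :
  U `<=` V -> Ck_on k V f -> Ck_on k U f.
Proof.
move=> UV; elim: k f => [|k IH] f /=; first by move=> H x /UV; exact: H.
by move=> [df H]; split=> [x /UV|v]; [exact: df | exact: IH].
Qed.

Lemma Ck_on_pred E F k (U : set E) (f : E -> F) :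
  Ck_on k.+1 U f -> Ck_on k U f.
Proof.
elim: k f => [|k IH] f [df H].
  by move=> x /df; exact: differentiable_continuous.
by split=> // v; apply: IH; exact: H.
Qed.

Lemma open_near E (U : set E) (P : E -> Prop) (x : E) :
  open U -> U x -> (forall y, U y -> P y) -> \near x, P x.
Proof.
move=> oU Ux H; apply: filterS H _; exact: open_nbhs_nbhs.
Qed.

Lemma Ck_on_eq E F k (U : set E) (f g : E -> F) : open U ->
  (forall x, U x -> f x = g x) -> Ck_on k U f -> Ck_on k U g.
Proof.
move=> oU; elim: k f g => [|k IH] f g fg /=.
  move=> cf x Ux; rewrite /prop_for /continuous_at -(fg x Ux).
  by apply: cvg_trans (cf x Ux); apply: near_eq_cvg; apply: open_near Ux _.
move=> [df H]; split=> [x Ux|v].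
  by apply: near_eq_differentiable (df x Ux); apply: open_near Ux _.
apply: (IH _ _ _ (H v)) => x Ux.
by apply: near_eq_derive; apply: open_near Ux _.
Qed.

Lemma Ck_on_cst E F k (U : set E) (a : F) : Ck_on k U (fun=> a).
Proof.
elim: k a => [|k IH] a /=; first by move=> x _; exact: cst_continuous.
split=> [x _|v]; first exact: differentiable_cst.
have -> : (fun x => 'D_v (fun=> a) x) = fun=> 0 :> F.
  by apply/funext => x; exact: derive_cst.
exact: IH.
Qed.

Lemma Ck_onD E F k (U : set E) (f g : E -> F) : open U ->
  Ck_on k U f -> Ck_on k U g -> Ck_on k U (fun x => f x + g x).
Proof.
move=> oU; elim: k f g => [|k IH] f g /=.
  by move=> cf cg x Ux; apply: continuousD; [exact: cf|exact: cg].
move=> [df Hf] [dg Hg]; split=> [x Ux|v].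
  exact: differentiableD (df x Ux) (dg x Ux).
apply: (Ck_on_eq oU _ (IH _ _ (Hf v) (Hg v))) => x Ux.
by rewrite -[RHS]/('D_v (f + g) x) deriveD//; apply: diff_derivable; auto.
Qed.

Lemma Ck_onN E F k (U : set E) (f : E -> F) : open U ->
  Ck_on k U f -> Ck_on k U (fun x => - f x).
Proof.
move=> oU; elim: k f => [|k IH] f.
  by move=> cf x Ux; apply: continuousN; exact: cf.
move=> [df Hf]; split=> [x Ux|v]; first exact: differentiableN (df x Ux).
apply: (Ck_on_eq oU _ (IH _ (Hf v))) => x Ux.
by rewrite -[RHS]/('D_v (- f) x) deriveN//; apply: diff_derivable; auto.
Qed.

Lemma Ck_onM E k (U : set E) (f g : E -> R) : open U ->
  Ck_on k U f -> Ck_on k U g -> Ck_on k U (fun x => f x * g x).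
Proof.
move=> oU; elim: k f g => [|k IH] f g.
  by move=> cf cg x Ux; apply: continuousM; [exact: cf|exact: cg].
move=> Cf Cg; have [df Hf] := Cf; have [dg Hg] := Cg.
split=> [x Ux|v]; first exact: differentiableM (df x Ux) (dg x Ux).
have := Ck_onD oU (IH _ _ (Ck_on_pred Cf) (Hg v))
                  (IH _ _ (Ck_on_pred Cg) (Hf v)).
apply: (Ck_on_eq oU) => x Ux.
by rewrite -[RHS]/('D_v (f * g) x) deriveM//; apply: diff_derivable; auto.
Qed.

Lemma Ck_on_sum E F k (U : set E) (I : Type) (s : seq I) (f : I -> E -> F) :
  open U -> (forall i, Ck_on k U (f i)) ->
  Ck_on k U (fun x => \sum_(i <- s) f i x).
Proof.
move=> oU Cf; elim: s => [|i s IH].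
  by apply: Ck_on_eq (Ck_on_cst k U 0) => // x _; rewrite big_nil.
by apply: Ck_on_eq (Ck_onD oU (Cf i) IH) => // x _; rewrite big_cons.
Qed.

(** An affine map has a constant derivative [A]: precomposing with it only turns
   the direction [v] of a derivative into [A v], so that induction on [k] goes
   through without a chain rule of higher order. *)
Lemma Ck_on_comp_affine E F G k (U : set F) (f : F -> G) (g : E -> F)
    (A : E -> F) :
  (forall x, differentiable g x) -> (forall x v, 'D_v g x = A v) ->
  Ck_on k U f -> open U -> Ck_on k (g @^-1` U) (f \o g).
Proof.
move=> dg gA + oU.
have oV : open (g @^-1` U).
  by apply: open_comp => // x _; exact: differentiable_continuous.
elim: k f => [|k IH] f.
  move=> cf x Ux; apply: continuous_comp; last exact: cf.
  exact: differentiable_continuous.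
move=> [df Hf]; split=> [x Ux|v].
  by apply: differentiable_comp => //; exact: df.
apply: Ck_on_eq (IH _ (Hf (A v))) => // x Ux.
by rewrite derive_comp ?gA//; exact: df.
Qed.

Lemma Ck_on_affine E F k (U : set E) (g : E -> F) (A : E -> F) :
  (forall x, differentiable g x) -> (forall x v, 'D_v g x = A v) ->
  Ck_on k U g.
Proof.
move=> dg gA; case: k => [|k].
  by move=> x _; exact: differentiable_continuous.
split=> // v; have -> : (fun x => 'D_v g x) = fun=> A v by exact/funext.
exact: Ck_on_cst.
Qed.

Lemma derive_linear E F (f : {linear E -> F}) (x v : E) :
  continuous f -> 'D_v f x = f v.
Proof.
by move=> cf; rewrite deriveE ?diff_lin//; exact: linear_differentiable.
Qed.

Lemma derive_coord E m n (f : E -> 'M[R]_(m, n)) (x v : E) i j :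
  differentiable f x -> 'D_v (fun y => f y i j) x = ('D_v f x) i j.
Proof. by move=> df; rewrite derive_mx ?mxE//; exact: diff_derivable. Qed.

Lemma differentiable_coord_comp E m n (f : E -> 'M[R]_(m, n)) (x : E) i j :
  differentiable f x -> differentiable (fun y => f y i j) x.
Proof.
move=> df.
by apply: (@differentiable_comp _ _ _ _ f (fun M : 'M[R]_(m, n) => M i j)) => //;
  exact: differentiable_coord.
Qed.

Lemma Ck_on_coord E m n k (U : set E) (f : E -> 'M[R]_(m, n)) i j :
  open U -> Ck_on k U f -> Ck_on k U (fun x => f x i j).
Proof.
move=> oU; elim: k f => [|k IH] f.
  move=> cf x Ux.
  apply: (@continuous_comp _ _ _ f (fun M : 'M[R]_(m, n) => M i j)).
    exact: cf.
  exact: coord_continuous.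
move=> [df Hf]; split=> [x Ux|v]; first by apply/differentiable_coord_comp/df.
by apply: Ck_on_eq (IH _ (Hf v)) => // x Ux; rewrite derive_coord//; exact: df.
Qed.

End Ck.

(** * Symmetry of second derivatives *)

Section Schwarz.
Variables (R : realType) (E : normedModType R).

Lemma is_derive_line (F : normedModType R) (f : E -> F) (p a : E) (s : R) :
  differentiable f (p + s *: a) ->
  is_derive s 1 (fun t => f (p + t *: a)) ('D_a f (p + s *: a)).
Proof.
move=> df.
have dL : is_derive s 1 (fun t : R => p + t *: a) a.
  have d1 : is_diff s ( *:%R ^~ a : R -> E) ( *:%R ^~ a).
    exact: is_diff_scalel.
  have d2 := is_diffD (is_diff_cst p s) d1.
  apply: DeriveDef; first by apply: diff_derivable; case: d2.
  rewrite deriveE; last by case: d2.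
  by rewrite (@diff_val _ _ _ _ _ _ _ d2) !fctE add0r scale1r.
have dL' : differentiable (fun t : R => p + t *: a) s.
  by apply/derivable1_diffP; case: dL.
apply: DeriveDef; first by apply/derivable1_diffP/differentiable_comp.
by rewrite [LHS](derive_comp _ dL' df) derive_val.
Qed.

Lemma is_diff_translate (c p : E) : is_diff p (fun y => y + c) id.
Proof.
have -> : id = id + 0 :> (E -> E) by rewrite addr0.
exact: is_diffD (is_diff_id p) (is_diff_cst c p).
Qed.

Lemma derive_translate (F : normedModType R) (f : E -> F) (c p v : E) :
  differentiable f (p + c) ->
  differentiable (fun y => f (y + c)) p /\
  'D_v (fun y => f (y + c)) p = 'D_v f (p + c).
Proof.
move=> df; have [dt dE] := is_diff_translate c p.
split; first by apply: (@differentiable_comp _ _ _ _ (fun y => y + c) f).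
rewrite -[LHS]/('D_v (f \o (fun y => y + c)) p).
by rewrite (derive_comp _ dt df) (deriveE _ dt) dE.
Qed.

Lemma MVT_line (f : E -> R) (p a : E) (h : R) : 0 < h ->
  (forall s, 0 <= s <= h -> differentiable f (p + s *: a)) ->
  exists2 s, 0 < s < h & f (p + h *: a) - f p = h * 'D_a f (p + s *: a).
Proof.
move=> h0 df.
have [||s + e] := @MVT R (fun t => f (p + t *: a))
    (fun t => 'D_a f (p + t *: a)) 0 h h0.
- move=> s; rewrite in_itv /= => /andP[s0 sh].
  by apply/is_derive_line/df; rewrite !ltW.
- apply: derivable_within_continuous => s; rewrite in_itv /= => sh.
  by have [] := is_derive_line (df s sh).
rewrite in_itv /= => sh; exists s => //.
by move: e; rewrite scale0r addr0 subr0 mulrC.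
Qed.

(** The second difference quotient of [f] along [a] and [b] is, by two uses of
   the mean value theorem, a value of the mixed derivative taken near [z]; it is
   symmetric in [a] and [b], which is why mixed derivatives commute. *)
Lemma second_difference (f : E -> R) (U V : set E) (z a b : E) :
  open U -> Ck_on 2 U f -> U z -> nbhs z V ->
  \forall h \near 0^'+, exists2 y, V y &
    f (z + h *: a + h *: b) - f (z + h *: a) - (f (z + h *: b) - f z) =
    h * (h * 'D_b (fun x => 'D_a f x) y).
Proof.
move=> oU [df Hf] Uz Vz.
have UVz : nbhs z (U `&` V) by apply: filterI => //; exact: open_nbhs_nbhs.
have : nbhs ((0 : R), (0 : R)) [set st | (U `&` V) (z + st.1 *: a + st.2 *: b)].
  have cL : (fun st : R * R => z + st.1 *: a + st.2 *: b) @ (0, 0) --> z.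
    rewrite -[X in _ --> X]addr0 -[X in _ --> X + _]addr0.
    apply: cvgD.
      apply: cvgD; first exact: cvg_cst.
      rewrite -(scale0r a); apply: cvgZr_tmp; exact: cvg_fst.
    rewrite -(scale0r b); apply: cvgZr_tmp; exact: cvg_snd.
  exact: cL.
move=> /nbhs_ballP[d d0 dUV]; rewrite /= in d0.
near=> h; have h0 : 0 < h by near: h; exact: nbhs_right_gt.
have hd : h < d by near: h; exact: nbhs_right_lt.
have inUV s t : 0 <= s <= h -> 0 <= t <= h ->
    (U `&` V) (z + s *: a + t *: b).
  move=> /andP[s0 sh] /andP[t0 th]; apply: (dUV (s, t)).
  by split; rewrite -ball_normE /= sub0r normrN ger0_norm//; lra.
pose g y := f (y + h *: b) - f y.
have dg s : 0 <= s <= h ->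
    differentiable f (z + s *: a + h *: b) /\ differentiable f (z + s *: a).
  move=> sh; split; apply: df; first by case: (inUV s h) => //; rewrite lexx ltW.
  by case: (inUV s 0) => //; rewrite ?scale0r ?addr0// lexx ltW.
have [|s sh] := @MVT_line g z a h h0.
  move=> s /dg[d1 d2]; apply: differentiableB => //; exact: (derive_translate 0 d1).1.
have sh' : 0 <= s <= h by case/andP: sh => ? ?; rewrite !ltW.
have -> : 'D_a g (z + s *: a) =
    'D_a f (z + s *: a + h *: b) - 'D_a f (z + s *: a).
  have [d1 d2] := dg s sh'.
  have [d1' <-] := derive_translate a d1.
  by rewrite [LHS]deriveB//; exact: diff_derivable.
have [|t th] := @MVT_line (fun x => 'D_a f x) (z + s *: a) b h h0.
  by move=> t th; case: (Hf a) => + _; apply; case: (inUV s t sh' th).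
move=> -> /= gE; exists (z + s *: a + t *: b).
  by case: (inUV s t) => //; case/andP: th => ? ?; rewrite !ltW.
by rewrite -gE /g; lra.
Unshelve. all: by end_near. Qed.

(** By continuity each mixed derivative is close to its value at [z] near [z];
   by [second_difference] the two share a value taken at two points near [z], so
   that their values at [z] are arbitrarily close. *)
Theorem derive_comm (f : E -> R) (U : set E) (z a b : E) :
  open U -> Ck_on 2 U f -> U z ->
  'D_a (fun x => 'D_b f x) z = 'D_b (fun x => 'D_a f x) z.
Proof.
move=> oU Cf Uz; apply/eqP; rewrite -subr_eq0 -normr_eq0; apply/negP => /negP.
set X := 'D_a _ _; set Y := 'D_b _ _ => XY.
have {XY}XY : 0 < `|X - Y| / 2 by rewrite divr_gt0// lt_def XY /=.
have cX : (fun x => 'D_a (fun x => 'D_b f x) x) @ z --> X.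
  by case: Cf => _ /(_ b)[_ /(_ a)]; apply.
have cY : (fun x => 'D_b (fun x => 'D_a f x) x) @ z --> Y.
  by case: Cf => _ /(_ a)[_ /(_ b)]; apply.
have /cvgrPdist_lt/(_ _ XY) nX := cX.
have /cvgrPdist_lt/(_ _ XY) nY := cY.
suff [h []] : exists h, [/\ 0 < h,
  exists2 y, `|Y - 'D_b (fun x => 'D_a f x) y| < `|X - Y| / 2 &
    f (z + h *: a + h *: b) - f (z + h *: a) - (f (z + h *: b) - f z) =
    h * (h * 'D_b (fun x => 'D_a f x) y) &
  exists2 y, `|X - 'D_a (fun x => 'D_b f x) y| < `|X - Y| / 2 &
    f (z + h *: b + h *: a) - f (z + h *: b) - (f (z + h *: a) - f z) =
    h * (h * 'D_a (fun x => 'D_b f x) y)].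
  move=> h0 [y yY +] [y' yX]; rewrite (addrAC z (h *: b)); clearbody X Y.
  move: yY yX.
  move: ('D_b _ y) ('D_a _ y') (f z) (f (z + h *: a)) (f (z + h *: b)) (f _).
  move=> B A p q u s yY yX e1 e2.
  have /eqP : h * (h * A) = h * (h * B) by rewrite -e1 -e2; ring.
  rewrite -subr_eq0 -!mulrBr !mulf_eq0 (gt_eqF h0) /= subr_eq0 => /eqP e3.
  by have := ler_distD B X Y; rewrite {}e3 in yX *; rewrite (distrC B); lra.
have [h] := @filter_ex _ (0^'+ : set_system R) _ _
  (filterI (nbhs_right_gt 0)
  (filterI (second_difference a b oU Cf Uz nY)
           (second_difference b a oU Cf Uz nX))).
move=> [h0 [h1 h2]]; exists h.
exact: And3 h0 h1 h2.
Qed.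

End Schwarz.

(** * The rate of change of the moving energy in coordinates *)

Lemma is_derive0_interval_cst (R : realType) (J : set R) (f : R -> R) :
  is_interval J -> (forall t, J t -> is_derive t 1 f 0) ->
  forall s t, J s -> J t -> f s = f t.
Proof.
move=> iJ df.
suff H s t : s <= t -> J s -> J t -> f s = f t.
  move=> s t Js Jt; case/orP: (le_total s t) => st; first exact: H.
  exact/esym/H.
move=> st Js Jt.
have stJ u : s <= u <= t -> J u by move=> su; exact: (iJ s t).
have [||u _] := @MVT_segment R f (fun=> 0) s t st.
- by move=> u; rewrite in_itv /= => /andP[su ut]; apply/df/stJ; rewrite !ltW.
- by apply: derivable_within_continuous => u /stJ/df[].
by rewrite mul0r => /eqP; rewrite subr_eq0 => /eqP.
Qed.

Section EnergyRate.
Variables (R : realType) (n : nat).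
Local Notation V := 'rV[R]_n.

Lemma pair_row_sum (u : V) :
  (0, u) = \sum_(i < n) u 0 i *: (0, delta_mx 0 i) :> V * V.
Proof.
rewrite [in LHS](row_sum_delta u); elim/big_rec2: _ => [//|i y x _ <-].
by congr pair => /=; rewrite scaler0 addr0.
Qed.

Lemma derive_fiber (l : V * V -> R) (z : V * V) (u : V) :
  differentiable l z ->
  'D_(0, u) l z = \sum_(i < n) u 0 i * 'D_(0, delta_mx 0 i) l z.
Proof.
move=> dl; rewrite pair_row_sum derive_dir_sum//.
by apply: eq_bigr => i _; rewrite derive_dirZ.
Qed.

(** With p = dl/dw and u = w - Y, the product rule gives
   (p.u - l)' = p.u' + p'.u - dl(w, w'), and (w, w') is the sum of (0, u'),
   (u, 0) and the tangent lift (Y, DY w): the term p.u' = dl(0, u') cancels, and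
   p'.u - dl(u, 0) is the Euler-Lagrange operator along u. *)
Lemma is_derive_moving_energy (l : V * V -> R) (U : set (V * V)) (x w : R -> V)
    (Y : V -> V) (t : R) :
  open U -> Ck_on 2 U l -> U (x t, w t) ->
  differentiable x t -> differentiable w t -> 'D_1 x t = w t ->
  differentiable Y (x t) ->
  is_derive t 1
    (fun s => 'D_(0, w s - Y (x s)) l (x s, w s) - l (x s, w s))
    ('D_1 (fun s => 'D_(0, w t - Y (x t)) l (x s, w s)) t
     - 'D_(w t - Y (x t), 0) l (x t, w t)
     - 'D_(Y (x t), 'D_(w t) Y (x t)) l (x t, w t)).
Proof.
move=> oU [dl Hl] Uz dx dw xw dY.
pose z s := (x s, w s); pose u s := w s - Y (x s).
pose P i s := 'D_(0, delta_mx 0 i : V) l (z s).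
have dz : differentiable z t by exact: differentiable_pair.
have Dz : 'D_1 z t = (w t, 'D_1 w t) by rewrite derive_pair// xw.
have near_dl : \near t, differentiable l (z t).
  have : \near t, U (z t).
    by apply: (differentiable_continuous dz); exact: open_nbhs_nbhs.
  by apply: filterS => s; exact: dl.
have dYx : differentiable (Y \o x) t by exact: differentiable_comp.
have du : differentiable u t by exact: differentiableB.
have Du : 'D_1 u t = 'D_1 w t - 'D_(w t) Y (x t).
  have DYx := derive_comp (1 : R^o) dx dY; rewrite xw in DYx.
  rewrite -DYx; exact: deriveB (diff_derivable dw) (diff_derivable dYx).
have dP i : differentiable (P i) t.
  apply: (@differentiable_comp _ _ _ _ z (fun y => 'D_(0, delta_mx 0 i) l y)) => //.
  by case: (Hl (0, delta_mx 0 i)) => + _; exact.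
have dlz : is_derive t 1 (l \o z) ('D_(w t, 'D_1 w t) l (z t)).
  apply: DeriveDef; last by rewrite derive_comp ?Dz//; exact: dl.
  by apply/diff_derivable/differentiable_comp => //; exact: dl.
have dPi i : is_derive t 1 (P i) ('D_1 (P i) t).
  by apply: derivableP; exact: diff_derivable.
have dui i : is_derive t 1 (fun s => u s 0 i) ('D_1 u t 0 i).
  apply: DeriveDef; last exact: derive_coord.
  exact/diff_derivable/differentiable_coord_comp.
have dsum : is_derive t 1 (fun s => \sum_(i < n) u s 0 i * P i s)
    (\sum_(i < n) (u t 0 i * 'D_1 (P i) t + 'D_1 u t 0 i * P i t)).
  have H i : is_derive t 1 ((fun s => u s 0 i) * P i)
     (u t 0 i * 'D_1 (P i) t + 'D_1 u t 0 i * P i t).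
    by apply: is_derive_eq; congr (_ + _); exact: mulrC.
  have := is_derive_sum H.
  by congr (is_derive _ _ _ _); apply/funext => s; rewrite fct_sumE.
have Dsum : 'D_1 (fun s => 'D_(0, u t) l (z s)) t =
    \sum_(i < n) u t 0 i * 'D_1 (P i) t.
  have H i : is_derive t 1 (u t 0 i *: P i) (u t 0 i *: 'D_1 (P i) t).
    exact: is_deriveZ.
  have := is_derive_sum H => /@derive_val <-; apply: near_eq_derive.
  apply: filterS near_dl => s dls.
  by rewrite derive_fiber// fct_sumE.
have fE : \near t, \sum_(i < n) u t 0 i * P i t = 'D_(0, u t) l (z t).
  by apply: filterS near_dl => s dls; rewrite derive_fiber.
have {}dsum := near_eq_is_derive fE dsum.
have := is_deriveB dsum dlz.
rewrite big_split /= -Dsum -derive_fiber; last exact: dl.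
move=> H; apply: (is_derive_eq H).
have -> : (w t, 'D_1 w t) =
    (0, 'D_1 u t) + (u t, 0) + (Y (x t), 'D_(w t) Y (x t)).
  rewrite Du; congr pair; rewrite /=; first by rewrite add0r subrK.
  by rewrite addr0 subrK.
have alg (a b c d : R) : a + b - (b + c + d) = a - c - d by ring.
have dlt := dl _ Uz.
by rewrite (derive_dirD _ _ dlt) (derive_dirD _ _ dlt) alg.
Qed.

End EnergyRate.

(** * Changes of charts *)

Section Charts.
Variables (R : realType) (n : nat) (Q : manifold R n).
Local Notation V := 'rV[R]_n.
Local Notation atl := (@atlas R n Q).

Lemma cim_map (c : chart R Q n) q : cdom c q -> cim c (c q).
Proof. by move=> cq; exists q. Qed.

Lemma cinvP (c : chart R Q n) x : cim c x ->
  cdom c (cinv c x) /\ c (cinv c x) = x.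
Proof. by case=> q cq <-; rewrite cmapK. Qed.

Lemma cim_nbhs (c : chart R Q n) x : cim c x -> nbhs x (cim c).
Proof. by move=> cx; apply: open_nbhs_nbhs; split; first exact: cim_open. Qed.

Lemma cdom_near (T : topologicalType) (f : T -> Q) (u : T) (c : chart R Q n) :
  {for u, continuous f} -> cdom c (f u) -> \near u, cdom c (f u).
Proof.
move=> cf cu; apply: cf; exact: open_nbhs_nbhs (conj (cdom_open c) cu).
Qed.

Lemma transition_differentiable (c1 c2 : chart R Q n) q :
  atl c1 -> atl c2 -> cdom c1 q -> cdom c2 q ->
  differentiable (c2 \o cinv c1) (c1 q).
Proof.
move=> a1 a2 q1 q2; case: (atlas_compatible a1 a2 1%N) => + _; apply.
by exists q.
Qed.

(** Near [u], the map [c2 \o f] factors as the transition map after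
   [c1 \o f]. *)
Lemma chart_change (E : normedModType R) (f : E -> Q) (u : E)
    (c1 c2 : chart R Q n) :
  atl c1 -> atl c2 -> {for u, continuous f} ->
  cdom c1 (f u) -> cdom c2 (f u) -> differentiable (c1 \o f) u ->
  differentiable (c2 \o f) u /\
  forall v, 'D_v (c2 \o f) u =
            'd (c2 \o cinv c1) (c1 (f u)) ('D_v (c1 \o f) u).
Proof.
move=> a1 a2 cf d1 d2 df.
have dt := transition_differentiable a1 a2 d1 d2.
have E12 : \near u, ((c2 \o cinv c1) \o (c1 \o f)) u = (c2 \o f) u.
  by apply: filterS (cdom_near cf d1) => y d1y /=; rewrite cmapK.
split=> [|v].
  by apply: near_eq_differentiable E12 _; exact: differentiable_comp.
by rewrite -(near_eq_derive _ E12) derive_comp// deriveE.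
Qed.

Lemma chart_cinv_derive (c : chart R Q n) x v : cim c x ->
  differentiable (c \o cinv c) x /\ 'D_v (c \o cinv c) x = v.
Proof.
move=> cx; have E : \near x, id x = (c \o cinv c) x.
  apply: (open_near (U := cim c)) => //; first exact: cim_open.
  by move=> y /cinvP[].
split; first exact: near_eq_differentiable E _.
by rewrite -(near_eq_derive _ E) derive_id.
Qed.

Lemma transitionK (c1 c2 : chart R Q n) q v :
  atl c1 -> atl c2 -> cdom c1 q -> cdom c2 q ->
  'd (c1 \o cinv c2) (c2 q) ('d (c2 \o cinv c1) (c1 q) v) = v.
Proof.
move=> a1 a2 q1 q2.
have dt := transition_differentiable a1 a2 q1 q2.
have [||||_ /(_ v)] := @chart_change _ (cinv c1) (c1 q) _ _ a2 a1.
- exact: cinv_continuous (cim_map q1).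
- by rewrite cmapK.
- by rewrite cmapK.
- exact: dt.
by rewrite (chart_cinv_derive v (cim_map q1)).2 cmapK// deriveE.
Qed.

Lemma tvec_tcoord (c : chart R Q n) q v : atl c -> cdom c q ->
  tvec c (c q) (tcoord c q v) = v.
Proof.
move=> ac cq; rewrite /tvec /tcoord cmapK//; apply: transitionK => //.
  exact: chart_at_atlas.
exact: chart_at_dom.
Qed.

Lemma tcoord_chart_at (q : Q) v : tcoord (chart_at q) q v = v.
Proof.
have cq := cim_map (chart_at_dom q).
by rewrite /tcoord -deriveE; have [] := chart_cinv_derive v cq.
Qed.

Lemma tvec_chart_at (q : Q) v : tvec (chart_at q) (chart_at q q) v = v.
Proof.
have := tvec_tcoord v (chart_at_atlas q) (chart_at_dom q).
by rewrite tcoord_chart_at.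
Qed.

Lemma velocity_chart (gamma : R -> Q) (t : R) (c : chart R Q n) :
  atl c -> {for t, continuous gamma} -> cdom c (gamma t) ->
  differentiable (c \o gamma) t ->
  velocity gamma t = tvec c (c (gamma t)) ('D_1 (c \o gamma) t).
Proof.
move=> ac cg cgt dg; rewrite /velocity derive1E /tvec cmapK//.
have ag := chart_at_atlas (gamma t); have dcg := chart_at_dom (gamma t).
by have [_ ->] := chart_change ac ag cg cgt dcg dg.
Qed.

Lemma vf_loc_tvec (c : chart R Q n) (Y : Q -> V) q : atl c -> cdom c q ->
  tvec c (c q) (vf_loc c Y (c q)) = Y q.
Proof. by move=> ac cq; rewrite /vf_loc cmapK// tvec_tcoord. Qed.

Lemma open_tangent_chart (c : chart R Q n) :
  open [set z : V * V | cim c z.1].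
Proof.
apply: (@open_comp _ _ (fun z : V * V => z.1) (cim c)).
  by move=> z _; exact: cvg_fst.
exact: cim_open.
Qed.

End Charts.

(** * The Lagrangian in bundle coordinates *)

Section Lagrangian.
Variables (R : realType) (n r : nat) (S : nh_system R n r).
Local Notation Q := (conf S).
Local Notation V := 'rV[R]_n.
Local Notation L := (lagrangian S).

Lemma pairingC (a u : V) : pairing a u = pairing u a.
Proof. by apply: eq_bigr => i _; rewrite mulrC. Qed.

Lemma pairingDr (a u v : V) : pairing a (u + v) = pairing a u + pairing a v.
Proof.
by rewrite /pairing -big_split; apply: eq_bigr => i _; rewrite mxE mulrDr.
Qed.

Lemma pairingNr (a u : V) : pairing a (- u) = - pairing a u.
Proof.
by rewrite /pairing -sumrN; apply: eq_bigr => i _; rewrite mxE mulrN.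
Qed.

Lemma pairingBr (a u v : V) : pairing a (u - v) = pairing a u - pairing a v.
Proof. by rewrite pairingDr pairingNr. Qed.

Lemma pairing_sumr (a : V) (w : V) (f : V -> V) : linear f ->
  pairing a (f w) = \sum_(i < n) w 0 i * pairing a (f (delta_mx 0 i)).
Proof.
move=> lf; pose g v := pairing a (f v).
have lg : linear g.
  move=> k u v; rewrite /g lf pairingDr; congr (_ + _).
  by rewrite /pairing scaler_sumr; apply: eq_bigr => i _; rewrite mxE mulrCA.
pose gM := GRing.isLinear.Build _ _ _ _ _ lg.
pose gL : {linear V -> R} := HB.pack g gM.
rewrite -[LHS]/(gL w) [in LHS](row_sum_delta w) linear_sum.
by apply: eq_bigr => i _; rewrite linearZ.
Qed.

Lemma pairing_suml (a : V) (w : V) (f : V -> V) : linear f ->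
  pairing (f w) a = \sum_(i < n) w 0 i * pairing (f (delta_mx 0 i)) a.
Proof.
move=> lf; rewrite pairingC pairing_sumr//.
by apply: eq_bigr => i _; rewrite pairingC.
Qed.

Lemma tvec_linear (c : chart R Q n) x : linear (tvec c x).
Proof. by move=> k u v; rewrite /tvec linearP. Qed.

(** The smoothness of the metric and of the 1-form is given componentwise, on
   fixed vectors; as [tvec] is linear, [L] is in bundle coordinates a quadratic
   polynomial in the velocity whose coefficients are these components. *)
Lemma lagrangian_Ck (c : chart R Q n) k : @atlas R n Q c ->
  Ck_on k [set z : V * V | cim c z.1] (tfun_loc c L).
Proof.
move=> ac; set U := [set z : V * V | _].
have oU : open U by exact: open_tangent_chart.
pose e i : V := delta_mx 0 i.
pose g i j x := pairing (tvec c x (e i) *m metric S (cinv c x)) (tvec c x (e j)).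
pose b i x := pairing (gyro S (cinv c x)) (tvec c x (e i)).
have cfst : continuous (fst : V * V -> V) by move=> z; exact: cvg_fst.
have csnd : continuous (snd : V * V -> V) by move=> z; exact: cvg_snd.
have fst_Ck f : smooth_on (cim c) f -> Ck_on k U (fun z : V * V => f z.1 : R).
  move=> sf.
  apply: (@Ck_on_comp_affine _ _ _ _ k (cim c) f (fun z : V * V => z.1) fst).
  - by move=> z; apply: linear_differentiable; exact: cfst.
  - by move=> z v; apply: derive_linear; exact: cfst.
  - exact: sf.
  - exact: cim_open.
have snd_Ck i : Ck_on k U (fun z : V * V => z.2 0 i : R).
  apply: (@Ck_on_coord _ _ _ _ _ U (fun z : V * V => z.2)) => //.
  apply: (@Ck_on_affine _ _ _ k U (fun z : V * V => z.2) snd).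
  - by move=> z; apply: linear_differentiable; exact: csnd.
  - by move=> z v; apply: derive_linear; exact: csnd.
have cst_Ck a : Ck_on k U (fun=> a : R) by exact: Ck_on_cst.
have L_expand (z : V * V) : 2^-1 * (\sum_(i < n) z.2 0 i *
       (\sum_(j < n) z.2 0 j * g i j z.1)) + \sum_(i < n) z.2 0 i * b i z.1
     + (-1) * potential S (cinv c z.1) = tfun_loc c L z.
  rewrite /tfun_loc /lagrangian mulN1r; congr (_ * _ + _ - _).
    rewrite (@pairing_suml _ _ (fun w => tvec c z.1 w *m metric S (cinv c z.1))).
      apply: eq_bigr => i _; congr (_ * _).
      by rewrite (pairing_sumr _ _ (@tvec_linear c _)).
    by move=> a u v; rewrite tvec_linear mulmxDl scalemxAl.
  by rewrite (pairing_sumr _ _ (@tvec_linear c _)).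
apply: (@Ck_on_eq _ _ _ _ U _ _ oU (fun z _ => L_expand z)).
apply: Ck_onD => //.
  apply: Ck_onD => //.
    apply: Ck_onM => //; apply: Ck_on_sum => // i; apply: Ck_onM => //.
    apply: Ck_on_sum => // j; apply: Ck_onM => //.
    by apply: fst_Ck; exact: metric_smooth.
  apply: Ck_on_sum => // i; apply: Ck_onM => //.
  by apply: fst_Ck; exact: gyro_smooth.
apply: Ck_onM => //.
apply: (fst_Ck (potential S \o cinv c)); exact: potential_smooth.
Qed.

Lemma lagrangian_differentiable (c : chart R Q n) z :
  @atlas R n Q c -> cim c z.1 -> differentiable (tfun_loc c L) z.
Proof. by move=> ac cz; case: (lagrangian_Ck 1 ac) => + _; exact. Qed.

(** In the preferred chart at [q], [tvec] is the identity of T_qQ, so that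
   [L q] is a restriction of the coordinate expression of [L]. *)
Lemma lagrangian_fiber_differentiable q v : differentiable (L q) v.
Proof.
have aq := chart_at_atlas q; have dq := cim_map (chart_at_dom q).
have [+ _] := @derive_fiber_incl _ _ _ _ _ _ v 0
  (@lagrangian_differentiable (chart_at q) (chart_at q q, v) aq dq).
congr (differentiable _ _); apply/funext => w.
by rewrite /tfun_loc /= cmapK ?tvec_chart_at//; exact: chart_at_dom.
Qed.

Lemma pairing_momentum q v u : pairing (momentum (S:=S) q v) u = 'D_u (L q) v.
Proof.
have dL := lagrangian_fiber_differentiable q v.
rewrite [in RHS](row_sum_delta u) derive_dir_sum//.
by apply: eq_bigr => i _; rewrite mxE derive_dirZ// mulrC.
Qed.

(** The momentum at [q] is defined in the preferred chart at [q]; as [tvec] is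
   linear on each fiber, the fiber derivative of [L] can be taken in any
   chart. *)
Lemma momentum_chart (c : chart R Q n) q w u : @atlas R n Q c -> cdom c q ->
  pairing (momentum (S:=S) q (tvec c (c q) w)) (tvec c (c q) u) =
  'D_(0, u) (tfun_loc c L) (c q, w).
Proof.
move=> ac cq; rewrite pairing_momentum.
have cx := cim_map cq.
have [_ <-] := derive_fiber_incl u
  (@lagrangian_differentiable c (c q, w) ac cx).
have -> : (fun v => tfun_loc c L (c q, v)) = L q \o tvec c (c q).
  by apply/funext => v; rewrite /tfun_loc /= cmapK.
have dc : differentiable ('d (chart_at (cinv c (c q)) \o cinv c) (c q)) w.
  apply: linear_differentiable; apply: diff_continuous.
  rewrite cmapK//; apply: transition_differentiable => //.
    exact: chart_at_atlas.
  exact: chart_at_dom.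
rewrite (derive_comp _ dc (lagrangian_fiber_differentiable q _)).
congr ('D__ _ _); rewrite derive_linear//.
apply: diff_continuous.
rewrite cmapK//; apply: transition_differentiable => //.
  exact: chart_at_atlas.
exact: chart_at_dom.
Qed.

Lemma moving_energy_chart (c : chart R Q n) (Y : Q -> V) q w :
  @atlas R n Q c -> cdom c q ->
  moving_energy Y q (tvec c (c q) w) =
  'D_(0, w - vf_loc c Y (c q)) (tfun_loc c L) (c q, w)
  - tfun_loc c L (c q, w).
Proof.
move=> ac cq; have cx := cim_map cq.
have dl := @lagrangian_differentiable c (c q, w) ac cx.
rewrite /moving_energy /energy -(vf_loc_tvec Y ac cq) !momentum_chart//.
rewrite addrAC; congr (_ - _); last by rewrite /tfun_loc /= cmapK.
rewrite -(derive_dirB _ _ dl).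
suff -> : (0, w) - (0, vf_loc c Y (c q)) = (0, w - vf_loc c Y (c q)) :> V * V by [].
by congr pair; rewrite /= subr0.
Qed.

End Lagrangian.

(** * The balance of the moving energy along solutions *)

Section Balance.
Variables (R : realType) (n r : nat) (S : nh_system R n r).
Local Notation Q := (conf S).
Local Notation V := 'rV[R]_n.
Local Notation L := (lagrangian S).
Local Notation Z := (drift S).
Local Notation D := (distr S).

(** Either [get] returns a covector that meets the specification of a reaction
   force, whose first clause is ideality, or no such covector exists and [get]
   returns the default row vector, which is 0. *)
Lemma reaction_force_ideal q v u :
  u \in D q -> pairing (reaction_force (S:=S) q v) u = 0.
Proof.
move=> uD; rewrite /reaction_force.
have [/getPex[ann _]|no] :=
    pselect (exists rho, is_reaction_force_at (S:=S) q v rho).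
  by rewrite pairingC; exact: (ann u uD).
rewrite getPN; last by move=> rho Hrho; apply: no; exists rho.
by rewrite /pairing big1// => i _; rewrite mxE mul0r.
Qed.

Lemma smooth_into_regular (J : set R) (gamma : R -> Q) (t : R) (c : chart R Q n) :
  @atlas R n Q c -> smooth_into J gamma -> J t -> cdom c (gamma t) ->
  [/\ {for t, continuous gamma}, differentiable (c \o gamma) t &
      differentiable (fun s => 'D_1 (c \o gamma) s) t].
Proof.
move=> ac [cg sg] Jt ct; split; first exact: cg.
  by case: (sg c ac 1%N) => + _; apply.
by case: (sg c ac 2%N) => _ /(_ 1)[+ _]; apply.
Qed.

Lemma smooth_vf_differentiable (Y : Q -> V) (c : chart R Q n) q :
  @atlas R n Q c -> smooth_vf_on setT Y -> cdom c q ->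
  differentiable (vf_loc c Y) (c q).
Proof.
by move=> ac sY cq; case: (sY c ac 1%N) => + _; apply; exists q.
Qed.

(** The representation of the velocity changes from point to point along
   [gamma], so the moving energy is first rewritten, for times close to [t], in
   the chart [chart_at (gamma t)]; there [is_derive_moving_energy] applies, and
   the equations of motion identify the Euler-Lagrange term. *)
Lemma is_derive_moving_energy_solution (J : set R) (gamma : R -> Q) (t : R)
    (Y : Q -> V) :
  open J -> solution J gamma -> J t -> smooth_vf_on setT Y ->
  let q := gamma t in let v := velocity gamma t in
  is_derive t 1 (fun s => moving_energy Y (gamma s) (velocity gamma s))
    (pairing (reaction_force q v) (v - Y q) - tangent_lift Y L q v).
Proof.
move=> oJ [sg eqm] Jt sY q v.
set c := chart_at q.
have ac : @atlas R n Q c by exact: chart_at_atlas.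
have cq : cdom c q by exact: chart_at_dom.
have [cg dx dw] := smooth_into_regular ac sg Jt cq.
pose x := c \o gamma; pose w s := 'D_1 x s.
have vE : v = w t by rewrite /v /velocity derive1E.
have dY : differentiable (vf_loc c Y) (x t) by exact: smooth_vf_differentiable.
have YE : vf_loc c Y (c q) = Y q by rewrite /vf_loc cmapK// tcoord_chart_at.
have [_ el] := eqm t Jt.
pose l := tfun_loc c L.
pose h s := 'D_(0, w s - vf_loc c Y (x s)) l (x s, w s) - l (x s, w s).
pose e s := moving_energy Y (gamma s) (velocity gamma s).
have dh : is_derive t 1 h ('D_1 (fun s => 'D_(0, v - Y q) l (x s, w s)) t
    - 'D_(v - Y q, 0) l (x t, v) - tangent_lift Y L q v).
  rewrite -YE vE; exact: (is_derive_moving_energy (open_tangent_chart (c:=c))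
    (lagrangian_Ck 2 ac) (cim_map cq : cim c (x t)) dx dw erefl dY).
have he : \near t, h t = e t.
  have nJ : \near t, J t by exact: open_nbhs_nbhs.
  have nc := cdom_near cg cq.
  near=> s.
  have Js : J s by near: s.
  have cs : cdom c (gamma s) by near: s.
  have [cgs dxs _] := smooth_into_regular ac sg Js cs.
  by rewrite /e (velocity_chart ac cgs cs dxs) moving_energy_chart.
have xw : derive1 x = w by apply/funext => s; exact: derive1E.
have := el (v - Y q); cbv zeta; rewrite -/q -/c -/x -/l -/v derive1E xw -vE.
move=> <-.
exact: near_eq_is_derive he dh.
Unshelve. all: by end_near. Qed.

(** For [v] in M the vector [v - Z] lies in [D], where an ideal reaction force
   does no work, and [v - y = (v - Z) - (y - Z)]. *)
Lemma reaction_power (q : Q) (v y : V) : cmanifold S q v ->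
  pairing (reaction_force (S:=S) q v) (v - y) =
  - pairing (reaction_force (S:=S) q v) (y - Z q).
Proof.
move=> Mv; have -> : v - y = (v - Z q) - (y - Z q) by rewrite opprB addrA subrK.
by rewrite pairingBr reaction_force_ideal// add0r.
Qed.

Lemma smooth_vfB (X Y : Q -> V) : smooth_vf_on setT X -> smooth_vf_on setT Y ->
  smooth_vf_on setT (fun q => X q - Y q).
Proof.
move=> sX sY c ac k.
have oU : open (c @` (cdom c `&` setT)) by rewrite setIT; exact: cim_open.
have := Ck_onD oU (sX c ac k) (Ck_onN oU (sY c ac k)).
by apply: Ck_on_eq => // x _; rewrite /vf_loc /tcoord linearB.
Qed.

(** As Y^TQ(L) = 0 on M, the rate of change of the moving energy along a solution
   is [- <R, Y - Z>]. Completeness of the dynamics is what turns the vanishing of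
   this rate along solutions into its vanishing at every point of M. *)
Theorem moving_energy_first_integral (hdyn : complete_dynamics S) (Y : Q -> V) :
  smooth_vf_on setT Y ->
  (forall q v, cmanifold S q v -> tangent_lift Y L q v = 0) ->
  first_integral (moving_energy Y) <-> section_RA S (fun q => Y q - Z q).
Proof.
move=> sY Y0.
have rate J gamma t : open J -> solution J gamma -> J t ->
    let q := gamma t in let v := velocity gamma t in
    is_derive t 1 (fun s => moving_energy Y (gamma s) (velocity gamma s))
      (- pairing (reaction_force q v) (Y q - Z q)).
  move=> oJ sol Jt q v.
  have Mv : cmanifold S q v by case: sol => _ /(_ t Jt)[].
  have := is_derive_moving_energy_solution oJ sol Jt sY.
  by rewrite /= Y0// subr0 reaction_power.
split=> [FI|[_ RA] J gamma oJ iJ sol].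
  split; first by apply: smooth_vfB => //; case: (drift_vf S).
  move=> q _ [v /= Mv <-].
  have [gamma [sol <- <-]] := hdyn q v Mv.
  have [_ dE] := rate setT gamma 0 openT sol I.
  apply: oppr_inj; rewrite oppr0 -[LHS]dE.
  have -> : (fun s => moving_energy Y (gamma s) (velocity gamma s)) =
      cst (moving_energy Y (gamma 0) (velocity gamma 0)).
    by apply/funext => s; apply: (FI setT) => //; exact: openT.
  exact: derive_cst.
apply: (is_derive0_interval_cst iJ) => t Jt.
have := rate J gamma t oJ sol Jt.
have Mv : cmanifold S (gamma t) (velocity gamma t).
  by case: sol => _ /(_ t Jt)[].
by rewrite /= RA ?oppr0//; exists (velocity gamma t).
Qed.

End Balance.

(** * The generator of a Lie group action *)

Section Action.
Variables (R : realType) (m n : nat) (G : lie_group R m) (Q : manifold R n).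
Variables (Psi : G -> Q -> Q) (exp : 'rV[R]_m -> G).
Hypotheses (Psi_action : lie_action Psi) (exp_map : exponential_map exp).
Variable xi : 'rV[R]_m.
Local Notation V := 'rV[R]_n.
Local Notation W := 'rV[R]_m.
Local Notation dG := (chart_at (gone G)).
Local Notation Y := (generator exp Psi xi).

Definition action_loc (c : chart R Q n) (z : W * V) : V :=
  c (Psi (cinv dG z.1) (cinv c z.2)).

Definition action_dom (c : chart R Q n) : set (W * V) :=
  [set z | [/\ cim dG z.1, cim c z.2 & cdom c (Psi (cinv dG z.1) (cinv c z.2))]].

Definition exp_coord (t : R) : W := dG (exp (t *: xi)).

Lemma action_loc_Ck c k : @atlas R n Q c -> Ck_on k (action_dom c) (action_loc c).
Proof.
move=> ac; have [[_ sP] _ _] := Psi_action.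
exact: (sP dG c c (chart_at_atlas _) ac ac k).
Qed.

Lemma action_dom_open c : open (action_dom c).
Proof.
rewrite openE => z [z1 z2 cz].
have n1 : \near z, cim dG z.1.
  by apply: (@cvg_fst _ _ (nbhs z.1) (nbhs z.2)); exact: cim_nbhs.
have n2 : \near z, cim c z.2.
  by apply: (@cvg_snd _ _ (nbhs z.1) (nbhs z.2)); exact: cim_nbhs.
pose f (z : W * V) := Psi (cinv dG z.1) (cinv c z.2).
have cf : {for z, continuous f}.
  have [[cP _] _ _] := Psi_action.
  apply: (@continuous_comp _ _ _ (fun z : W * V => (cinv dG z.1, cinv c z.2))
     (fun y : G * Q => Psi y.1 y.2)); last exact: cP.
  apply: cvg_pair => /=.
    apply: (@continuous_comp _ _ _ fst (cinv dG)); first exact: cvg_fst.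
    exact: cinv_continuous.
  apply: (@continuous_comp _ _ _ snd (cinv c)); first exact: cvg_snd.
  exact: cinv_continuous.
have n3 := cdom_near cf cz.
by near=> y; split; near: y.
Unshelve. all: by end_near. Qed.

Lemma action_dom1 c x : cim c x -> action_dom c (dG (gone G), x).
Proof.
move=> cx; have [_ P1 _] := Psi_action; have [cdx _] := cinvP cx.
split=> //=; first exact: cim_map (chart_at_dom _).
by rewrite cmapK ?P1//; exact: chart_at_dom.
Qed.

Lemma action_loc1 c x : cim c x -> action_loc c (dG (gone G), x) = x.
Proof.
move=> cx; have [_ P1 _] := Psi_action; have [_ cK] := cinvP cx.
by rewrite /action_loc /= cmapK ?P1//; exact: chart_at_dom.
Qed.

Lemma exp0 : exp (0 *: xi) = gone G.
Proof. by rewrite scale0r; case: (exp_map 0). Qed.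

Lemma exp_coord0 : exp_coord 0 = dG (gone G).
Proof. by rewrite /exp_coord exp0. Qed.

Lemma exp_continuous0 : {for 0, continuous (fun t : R => exp (t *: xi))}.
Proof. by have [[ce _] _ _ _] := exp_map xi; exact: ce. Qed.

Lemma exp_near : \forall t \near (0 : R), cdom dG (exp (t *: xi)).
Proof.
by apply: cdom_near exp_continuous0 _; rewrite exp0; exact: chart_at_dom.
Qed.

Lemma exp_coord_differentiable : differentiable exp_coord (0 : R).
Proof.
have [[_ se] _ _ _] := exp_map xi.
case: (se dG (chart_at_atlas _) 1%N) => + _; apply; split=> //=.
by rewrite exp0; exact: chart_at_dom.
Qed.

Lemma action_curve_near c x : cim c x -> \forall t \near (0 : R),
  action_dom c (exp_coord t, x) /\
  action_loc c (exp_coord t, x) = c (Psi (exp (t *: xi)) (cinv c x)).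
Proof.
move=> cx.
have dz : differentiable (fun t => (exp_coord t, x)) (0 : R).
  by apply: differentiable_pair => //; exact: exp_coord_differentiable.
have n1 : \forall t \near (0 : R), action_dom c (exp_coord t, x).
  apply: (differentiable_continuous dz); apply: open_nbhs_nbhs.
  by split; [exact: action_dom_open | rewrite exp_coord0; exact: action_dom1].
have n2 := exp_near.
near=> t; split; first by near: t.
by rewrite /action_loc /= cmapK//; near: t.
Unshelve. all: by end_near. Qed.

(** The generator at each point [q] is computed in the chart [chart_at q]; in a
   fixed chart it becomes a partial derivative of the smooth map [action_loc],
   in a direction that does not depend on [x]. *)
Lemma generator_loc c x : @atlas R n Q c -> cim c x ->
  vf_loc c Y x = 'D_('D_1 exp_coord 0, 0) (action_loc c) (dG (gone G), x).
Proof.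
move=> ac cx; have [cq cK] := cinvP cx; set q := cinv c x.
have [_ P1 _] := Psi_action.
pose g (t : R) := Psi (exp (t *: xi)) q.
have g0 : g 0 = q by rewrite /g exp0 P1.
have dz : differentiable (fun t => (exp_coord t, x)) (0 : R).
  by apply: differentiable_pair => //; exact: exp_coord_differentiable.
have dF : differentiable (action_loc c) (exp_coord 0, x).
  by case: (action_loc_Ck 1 ac) => + _; apply; rewrite exp_coord0; exact: action_dom1.
have gE : \forall t \near (0 : R),
    (action_loc c \o (fun t => (exp_coord t, x))) t = (c \o g) t.
  by apply: filterS (action_curve_near cx) => t [].
have dg : differentiable (c \o g) (0 : R).
  by apply: near_eq_differentiable gE _; exact: differentiable_comp.
have cg : {for (0 : R), continuous g}.
  have [[cP _] _ _] := Psi_action.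
  apply: (@continuous_comp _ _ _ (fun t : R => (exp (t *: xi), q))
     (fun y : G * Q => Psi y.1 y.2)); last exact: cP.
  by apply: cvg_pair => /=; [exact: exp_continuous0 | exact: cvg_cst].
have aq := chart_at_atlas q; have dq := chart_at_dom q.
have [||_ /(_ 1) gD] := chart_change ac aq cg _ _ dg; rewrite ?g0//.
have -> : vf_loc c Y x = tcoord c q ('D_1 (chart_at q \o g) 0).
  by rewrite /vf_loc -/q /generator derive1E.
have dx : differentiable (fun=> x) (0 : R) by exact: differentiable_cst.
have -> : 'D_('D_1 exp_coord 0, 0) (action_loc c) (dG (gone G), x) = 'D_1 (c \o g) 0.
  rewrite -(near_eq_derive (1 : R) gE) (derive_comp (1 : R) dz dF).
  by rewrite (derive_pair (1 : R) exp_coord_differentiable dx) derive_cst exp_coord0.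
rewrite gD g0; exact: transitionK.
Qed.

Lemma generator_smooth : smooth_vf_on setT Y.
Proof.
move=> c ac k; rewrite setIT.
apply: Ck_on_eq (fun x cx => esym (generator_loc ac cx)) _; first exact: cim_open.
pose s (x : V) : W * V := (dG (gone G), x).
have := @Ck_on_comp_affine _ _ _ _ k (action_dom c)
  (fun z => 'D_('D_1 exp_coord 0, 0) (action_loc c) z) s (fun v => (0, v)).
have ds x : is_diff x s (fun v => (0, v)) by exact: is_diff_fiber.
move=> H; apply: (Ck_on_sub (V := s @^-1` action_dom c)).
  by move=> x cx; exact: action_dom1.
apply: H.
- by move=> x; case: (ds x).
- by move=> x v; have [dsx dsE] := ds x; rewrite deriveE// dsE.
- by have [_] := action_loc_Ck k.+1 ac; apply.
- exact: action_dom_open.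
Qed.

(** By [generator_loc] both sides are mixed second derivatives of [action_loc]
   at the identity. As [derive_comm] is about real functions, it is applied to
   the components. *)
Lemma action_mixed c x v : @atlas R n Q c -> cim c x ->
  'D_('D_1 exp_coord 0, 0) (fun z => 'D_(0, v) (action_loc c) z) (dG (gone G), x) =
  'D_v (vf_loc c Y) x.
Proof.
move=> ac cx.
set a : W * V := ('D_1 exp_coord 0, 0); set z : W * V := (dG (gone G), x).
have Uz : action_dom c z by exact: action_dom1.
have oU : open (action_dom c) by exact: action_dom_open.
have C2 := action_loc_Ck 2 ac.
have [dF HF] := C2.
pose s (x : V) : W * V := (dG (gone G), x).
have [dsx dsE] : is_diff x s (fun v => (0, v)) by exact: is_diff_fiber.
have -> : 'D_v (vf_loc c Y) x = 'D_(0, v) (fun z => 'D_a (action_loc c) z) z.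
  have E : \near x, ((fun z => 'D_a (action_loc c) z) \o s) x = vf_loc c Y x.
    apply: (open_near (U := cim c)) => //; first exact: cim_open.
    by move=> y cy; rewrite generator_loc.
  have dFa : differentiable (fun z => 'D_a (action_loc c) z) (s x).
    by case: (HF a) => + _; exact.
  by rewrite -(near_eq_derive v E) (derive_comp v dsx dFa) (deriveE v dsx) dsE.
apply/rowP => i.
have C2i := Ck_on_coord 0 i oU C2.
have coord u u' : 'D_u (fun z => 'D_u' (fun z => action_loc c z 0 i) z) z =
    ('D_u (fun z => 'D_u' (action_loc c) z) z) 0 i.
  have -> : 'D_u (fun z => 'D_u' (fun z => action_loc c z 0 i) z) z =
    'D_u (fun z => 'D_u' (action_loc c) z 0 i) z.
    apply: near_eq_derive; apply: (open_near oU Uz) => y Uy.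
    by rewrite derive_coord//; exact: dF.
  by rewrite derive_coord//; case: (HF u') => + _; exact.
have mixed := derive_comm a (0, v) oU C2i Uz.
exact: etrans (esym (coord a (0, v))) (etrans mixed (coord (0, v) a)).
Qed.

End Action.

(** * Invariant Lagrangians *)

Section Invariance.
Variables (R : realType) (n r : nat) (S : nh_system R n r).
Variables (m : nat) (G : lie_group R m) (Psi : G -> conf S -> conf S).
Variables (exp : 'rV[R]_m -> G) (xi : 'rV[R]_m).
Hypotheses (Psi_action : lie_action Psi) (exp_map : exponential_map exp).
Hypothesis L_invariant : forall g q v,
  lagrangian S (Psi g q) (tangent_map (Psi g) q v) = lagrangian S q v.
Local Notation V := 'rV[R]_n.
Local Notation W := 'rV[R]_m.
Local Notation dG := (chart_at (gone G)).

(** In bundle coordinates the orbit of [(q, v)] under the lifted one-parameter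
   group is a curve [(H, K)], with [K] the derivative of the action along [v].
   The Lagrangian is constant along it, and its velocity at 0 is the tangent
   lift of the generator, by [generator_loc] and [action_mixed]. *)
Lemma invariant_tangent_lift q v :
  tangent_lift (generator exp Psi xi) (lagrangian S) q v = 0.
Proof.
set c := chart_at q; set x := c q.
have ac : atlas c := chart_at_atlas q.
have cq : cdom c q := chart_at_dom q.
have cx : cim c x := cim_map cq.
have [[cP sP] P1 _] := Psi_action.
pose F := action_loc Psi c; pose phi := exp_coord exp xi.
pose a : W * V := ('D_1 phi 0, 0).
pose z t := (phi t, x).
pose H t := F (z t); pose K t := 'D_(0, v) F (z t).
pose l := tfun_loc c (lagrangian S).
have z0 : z 0 = (dG (gone G), x) by rewrite /z /phi exp_coord0.
have Uz0 : action_dom Psi c (z 0) by rewrite z0; exact: action_dom1.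
have [dF HF] := action_loc_Ck Psi_action 2 ac.
have dphi : differentiable phi 0 := exp_coord_differentiable exp_map xi.
have dz : differentiable z 0 by exact: differentiable_pair.
have Dz : 'D_1 z 0 = a.
  by rewrite (derive_pair (1 : R) dphi (differentiable_cst x (0 : R))) derive_cst.
have dH : differentiable H 0 by exact: (differentiable_comp dz (dF _ Uz0)).
have dFv : differentiable (fun y => 'D_(0, v) F y) (z 0).
  by case: (HF (0, v)) => + _; exact.
have dK : differentiable K 0.
  exact: (differentiable_comp dz dFv).
have DH : 'D_1 H 0 = vf_loc c (generator exp Psi xi) x.
  rewrite (generator_loc Psi_action exp_map xi ac cx).
  by have := derive_comp (1 : R) dz (dF _ Uz0); rewrite Dz z0.
have DK : 'D_1 K 0 = 'D_v (vf_loc c (generator exp Psi xi)) x.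
  rewrite -(action_mixed Psi_action exp_map xi v ac cx).
  by have := derive_comp (1 : R) dz dFv; rewrite Dz z0.
have H0 : H 0 = x by rewrite /H z0 /F action_loc1.
have fiber y1 y2 : action_dom Psi c (y1, y2) ->
    differentiable (fun u => F (y1, u)) y2 /\
    'D_v (fun u => F (y1, u)) y2 = 'D_(0, v) F (y1, y2).
  by move=> Uy; exact: derive_fiber_incl (dF _ Uy).
(* The identity of G acts as the identity, so that K starts at v. *)
have K0 : K 0 = v.
  have [_ E] := fiber _ _ (action_dom1 Psi_action cx).
  rewrite /K z0 -E -[RHS](derive_id x v); apply: near_eq_derive.
  apply: (open_near (U := cim c)) => //; first exact: cim_open.
  by move=> y cy; rewrite /F action_loc1.
(* With g = exp (t xi), the pair (H t, K t) consists of the coordinates of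
   Psi_g(q) and of T Psi_g(v). *)
have lconst : \forall t \near (0 : R), (l \o (fun t => (H t, K t))) t =
    cst (lagrangian S q v) t.
  near=> t.
  have [Ut FE] : action_dom Psi c (phi t, x) /\
      F (phi t, x) = c (Psi (exp (t *: xi)) (cinv c x)).
    by near: t; exact: action_curve_near.
  have Gt : cdom dG (exp (t *: xi)) by near: t; exact: exp_near.
  set g := exp (t *: xi) in FE Gt *.
  have xq : cinv c x = q by rewrite /x cmapK.
  rewrite xq in FE.
  have cg : cdom c (Psi g q).
    by case: Ut => _ _ /=; rewrite /phi /exp_coord cmapK// xq.
  pose f := Psi g \o cinv c.
  have fx : f x = Psi g q by rewrite /f /= xq.
  have cf : {for x, continuous f}.
    apply: continuous_comp; first exact: cinv_continuous.
    apply: (@continuous_comp _ _ _ (fun y => (g, y))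
      (fun y : G * conf S => Psi y.1 y.2)); last exact: cP.
    by apply: cvg_pair => /=; [exact: cvg_cst | exact: cvg_id].
  have fE : (fun u => F (phi t, u)) = c \o f.
    by apply/funext => u; rewrite /F /action_loc /= /phi /exp_coord cmapK.
  have [dcf KE] : differentiable (c \o f) x /\ 'D_v (c \o f) x = K t.
    by rewrite -fE; exact: fiber.
  have ag := chart_at_atlas (Psi g q); have dg := chart_at_dom (Psi g q).
  have [||dgf /(_ v) gD] := chart_change ac ag cf _ _ dcf; rewrite ?fx//.
  rewrite /= /l /tfun_loc /= /H -/(z t) FE cmapK// -(L_invariant g q v).
  congr (lagrangian S _ _); rewrite /tvec (cmapK cg) -KE.
  rewrite fx in gD; rewrite -gD.
  by rewrite /tangent_map -deriveE.
have dHK : differentiable (fun t : R => (H t, K t)) (0 : R).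
  exact: differentiable_pair dH dK.
have dl : differentiable l (H 0, K 0).
  by rewrite H0 K0; exact: (lagrangian_differentiable (z := (x, v)) ac cx).
have : 'D_1 (l \o (fun t => (H t, K t))) (0 : R) = 0.
  rewrite (near_eq_derive (1 : R) lconst).
  exact: derive_cst.
by rewrite (derive_comp (1 : R) dHK dl) (derive_pair (1 : R) dH dK) DH DK H0 K0.
Unshelve. all: by end_near. Qed.

End Invariance.

(** * First integrals *)

Theorem corollary5 (R : realType) (n r : nat) (S : nh_system R n r)
    (hdyn : complete_dynamics S) :
  (forall Y : conf S -> 'rV[R]_n, vector_field Y ->
     (forall q v, cmanifold S q v -> tangent_lift Y (lagrangian S) q v = 0) ->
     (first_integral (moving_energy Y) <->
      section_RA S (fun q => Y q - drift S q)))
  /\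
  ((forall q v, cmanifold S q v ->
      tangent_lift (drift S) (lagrangian S) q v = 0) ->
   first_integral (moving_energy (drift S)))
  /\
  (forall (m : nat) (G : lie_group R m) (Psi : G -> conf S -> conf S)
     (exp : 'rV[R]_m -> G),
     lie_action Psi -> exponential_map exp ->
     (forall g q v,
        lagrangian S (Psi g q) (tangent_map (Psi g) q v) = lagrangian S q v) ->
     forall xi : 'rV[R]_m,
       first_integral (moving_energy (generator exp Psi xi)) <->
       section_RA S (fun q => generator exp Psi xi q - drift S q)).
Proof.
split=> [Y [sY _] Y0|]; first exact: moving_energy_first_integral.
have [sZ _] := drift_vf S.
split=> [Z0|m G Psi exp aP eP LP xi].
  apply/(moving_energy_first_integral hdyn sZ Z0); split; first exact: smooth_vfB.
  move=> q rho _; rewrite subrr.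
  by rewrite /pairing big1// => i _; rewrite mxE mulr0.
apply: moving_energy_first_integral => //; first exact: generator_smooth.
by move=> q v _; exact: invariant_tangent_lift.
Qed.
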